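(* For $k\ge3$ and $1\le i\le k-1$, let $\sigma_i$ be the vincular pattern of length $k+1$ given by $\sigma_i=12\cdots i\,(i+2)(i+3)\cdots(k+1)\text{-}(i+1)$. Then $\sigma_i$ and $\sigma_j$ are Wilf-equivalent for all $1\le i,j\le k-1$. Moreover these equivalences respect the first letter statistic: for all $n\ge1$, $a\in[n]$ and $1\le i,j\le k-1$, the number of $\pi\in\mathcal{S}_n(\sigma_i)$ with $\pi_1=a$ equals the number of $\pi\in\mathcal{S}_n(\sigma_j)$ with $\pi_1=a$.
   Context: A vincular pattern is a permutation $\rho\in\mathcal{S}_m$ written with dashes between some consecutive entries; $\pi\in\mathcal{S}_n$ contains it if there are indices $i_1<\cdots<i_m$ with $\pi_{i_1}\cdots\pi_{i_m}$ order-isomorphic to $\rho$ and $i_{j+1}=i_j+1$ whenever $\rho_j,\rho_{j+1}$ are not separated by a dash; otherwise $\pi$ avoids it. (So in $\sigma_i$ the first $k$ letters must be consecutive in $\pi$.) $\mathcal{S}_n(\rho)$ is the set of $\rho$-avoiding permutations in $\mathcal{S}_n$. Patterns are Wilf-equivalent if $|\mathcal{S}_n(\rho)|=|\mathcal{S}_n(\rho')|$ for all $n\ge0$. *)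

(* Defs.v *)
From mathcomp Require Import all_boot all_fingroup.

Set Implicit Arguments.
Unset Strict Implicit.
Unset Printing Implicit Defensive.

(* Permutations of [n] are elements of 'S_n: positions and letters are both
   counted from 0, so the letter pi_x of the usual one-line notation is
   (pi (x - 1)).+1. *)

(* A dash [d] separates the entries at (0-based) positions [d] and [d.+1]. *)
Record vincular := Vincular {
  vlen : nat;
  vperm : 'S_vlen;
  vdash : {set 'I_vlen.-1}
}.

(* [f] lists the positions in [pi] of an occurrence of [rho]. *)
Definition occurrence (rho : vincular) (n : nat) (pi : 'S_n)
    (f : {ffun 'I_(vlen rho) -> 'I_n}) : bool :=
  [&& [forall p : 'I_(vlen rho), forall q : 'I_(vlen rho),
         (p < q) ==> (f p < f q)],
      [forall p : 'I_(vlen rho), forall q : 'I_(vlen rho),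
         (pi (f p) < pi (f q)) == (vperm rho p < vperm rho q)]
    & [forall d : 'I_(vlen rho).-1,
       forall p : 'I_(vlen rho), forall q : 'I_(vlen rho),
         [&& d \notin vdash rho, p == d :> nat & q == d.+1 :> nat] ==>
         (f q == (f p).+1 :> nat)]].

Definition contains (rho : vincular) (n : nat) (pi : 'S_n) : bool :=
  [exists f : {ffun 'I_(vlen rho) -> 'I_n}, occurrence pi f].

Definition avoiders (rho : vincular) (n : nat) : {set 'S_n} :=
  [set pi : 'S_n | ~~ contains rho pi].

Definition wilf_equivalent (rho rho' : vincular) : Prop :=
  forall n : nat, #|avoiders rho n| = #|avoiders rho' n|.

(* 12...i (i+2)(i+3)...(k+1)-(i+1), meaningful for i <= k: the last position
   is sent to the letter i (0-based) and the others increasingly to the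
   remaining letters; see [sigma_one_line]. *)
Definition sigma (k i : nat) : vincular :=
  @Vincular k.+1 (lift_perm ord_max (inord i) 1%g)
    [set d : 'I_k | d.+1 == k].

Lemma sigma_one_line (k i : nat) : i <= k ->
  [seq (val (vperm (sigma k i) p)).+1 | p <- enum 'I_k.+1]
  = iota 1 i ++ iota i.+2 (k - i) ++ [:: i.+1].
Proof.
move=> le_ik; rewrite enum_ordSr map_rcons -cats1 catA; congr (_ ++ _); last first.
  by rewrite /= lift_perm_id inordK.
have sz_w : size [seq widen_ord (leqnSn k) p | p <- enum 'I_k] = k.
  by rewrite size_map size_enum_ord.
apply: (@eq_from_nth _ 0) => [|x].
  by rewrite size_map sz_w size_cat !size_iota subnKC.
rewrite size_map sz_w => lt_xk.
have -> : [seq widen_ord (leqnSn k) p | p <- enum 'I_k]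
   = [seq lift ord_max p | p <- enum 'I_k].
  by apply: eq_map => p; apply: val_inj; rewrite [RHS]lift_max.
rewrite -map_comp (nth_map (Ordinal lt_xk)) ?size_enum_ord //=.
rewrite lift_perm_lift perm1 /= inordK // nth_enum_ord // nth_cat size_iota /bump.
case: ltnP => [lt_xi | le_ix]; first by rewrite nth_iota.
rewrite nth_iota; last by rewrite ltn_sub2r ?(leq_ltn_trans le_ix).
by rewrite !addSn subnKC.
Qed.

(* Main.v *)
(* Replace a permutation by its Lehmer code c_1 ... c_n, where c_q counts the
   later smaller letters, so that 0 <= c_q <= n - q. The permutation ascends at
   q iff c_q <= c_{q+1}, and then c_q = c_{q+1} iff no later letter lies
   strictly between the two. Avoiding sigma_i thus means that in each weakly
   increasing window of k consecutive codes the i-th and (i+1)-st are equal. In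
   a maximal weakly increasing run of length l >= k, this says that the i-th
   entry is followed by l + 1 - k extra copies of itself. Moving these copies
   behind the j-th entry of the remaining word of length k - 1 keeps the first
   and the last entry of each run, hence the descents between runs and the
   bounds on the codes (which only matter at the last entry of a run), and
   turns codes of sigma_i-avoiders into codes of sigma_j-avoiders. *)
Require Import Defs.
From mathcomp Require Import all_boot all_order all_fingroup zify.

Set Implicit Arguments.
Unset Strict Implicit.
Unset Printing Implicit Defensive.

(** * Lehmer codes as a bijective encoding *)

Fixpoint lehmer (s : seq nat) : seq nat :=
  if s is x :: s' then count (fun y => y < x) s' :: lehmer s' else [::].

Fixpoint subdiagonal (c : seq nat) : bool :=
  if c is x :: c' then (x <= size c') && subdiagonal c' else true.

Lemma size_lehmer s : size (lehmer s) = size s.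
Proof. by elim: s => //= x s ->. Qed.

Lemma subdiagonal_lehmer s : subdiagonal (lehmer s).
Proof. by elim: s => //= x s ->; rewrite size_lehmer count_size. Qed.

Lemma nth_lehmer s t : t < size s ->
  nth 0 (lehmer s) t = count (fun y => y < nth 0 s t) (drop t.+1 s).
Proof.
by elim: s t => // x s IH [_|t] /=; rewrite ?drop0 // ltnS => /IH.
Qed.

Lemma count_ltn_mono s x y : x <= y ->
  count (fun z => z < x) s <= count (fun z => z < y) s.
Proof. by move=> le_xy; apply: sub_count => z /= /leq_trans; apply. Qed.

Lemma count_ltn_strict s x y : x < y -> x \in s ->
  count (fun z => z < x) s < count (fun z => z < y) s.
Proof.
move=> lt_xy; elim: s => //= z s IH; rewrite inE => /orP[/eqP <-|/IH].
  by have := count_ltn_mono s (ltnW lt_xy); rewrite ltnn lt_xy; lia.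
by case: (ltnP z x); case: (ltnP z y); lia.
Qed.

(** The code determines the first letter: if [x < y], strictly fewer letters of the common multiset
    lie below [x] than below [y], because [x] itself counts only for [y]. *)
Lemma lehmer_inj (s t : seq nat) : perm_eq s t -> lehmer s = lehmer t -> s = t.
Proof.
elim: s t => [|x s IH] [|y t] //; try by move=> /perm_size.
move=> eq_st [eq_xy eq_c].
have cnt u : count (fun z => z < u) (x :: s) = count (fun z => z < u) (y :: t).
  by move/seq.permP: eq_st => ->.
have eqxy : x = y.
  case: (ltngtP x y) => // lt_xy.
    have := count_ltn_strict lt_xy (mem_head x s).
    by rewrite [X in _ < X]cnt /= !ltnn; lia.
  have := count_ltn_strict lt_xy (mem_head y t).
  by rewrite -[X in _ < X]cnt /= !ltnn; lia.
by move: eq_st; rewrite -eqxy perm_cons => /IH ->.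
Qed.

(** Greedy decoding: the first letter must have rank [x] in [l], counted from 0, and the rest of the
    code is decoded with the remaining letters. *)
Lemma lehmer_surj c (l : seq nat) : uniq l -> size l = size c -> subdiagonal c ->
  exists2 s, perm_eq s l & lehmer s = c.
Proof.
elim: c l => [|x c IH] l uniq_l; first by move/size0nil->; exists [::].
move=> size_l /andP[le_xc sub_c].
have perm_l := permEl (perm_sort leq l).
have sorted_l : sorted ltn (sort leq l).
  by rewrite ltn_sorted_uniq_leq sort_uniq uniq_l sort_sorted //; apply: leq_total.
have lt_x : x < size (sort leq l) by rewrite size_sort size_l ltnS.
set y := nth 0 (sort leq l) x.
have y_l : y \in l by rewrite -(perm_mem perm_l) mem_nth.
have cnt : count (fun z => z < y) l = x.
  by move/seq.permP: perm_l => <-;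
  exact: (@Order.POrderTheory.count_lt_nth _ nat 0 _ x sorted_l lt_x).
have perm_y := perm_to_rem y_l.
have [||s perm_s eq_s] := IH (rem y l) _ _ sub_c.
- exact: rem_uniq.
- by rewrite size_rem // size_l.
exists (y :: s); first by rewrite perm_sym (permPl perm_y) perm_cons perm_sym.
rewrite /= eq_s; congr (_ :: _).
by rewrite -[RHS]cnt; move/seq.permP: perm_y => ->; move/seq.permP: perm_s => ->; rewrite /= ltnn.
Qed.

(** * Factorization of a code into weakly increasing runs *)

(* The entries at 0-based positions [(p + i).-1] and [p + i] are the [i]-th and
   [i.+1]-st of the window starting at [p]. *)
Definition code_avoids (k i : nat) (c : seq nat) : Prop :=
  forall p, p + k <= size c ->
    (forall t, t.+1 < k -> nth 0 c (p + t) <= nth 0 c (p + t).+1) ->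
  nth 0 c (p + i).-1 = nth 0 c (p + i).

Definition descent_between (r s : seq nat) : bool := head 0 s < last 0 r.

Definition is_run_seq (rs : seq (seq nat)) : bool :=
  all (fun r => (0 < size r) && sorted leq r) rs && sorted descent_between rs.

Fixpoint runs (c : seq nat) : seq (seq nat) :=
  if c is x :: c' then
    if runs c' is (y :: r) :: rs then
      if x <= y then (x :: y :: r) :: rs else [:: x] :: (y :: r) :: rs
    else [:: [:: x]]
  else [::].

Lemma runs_spec c : is_run_seq (runs c) /\ flatten (runs c) = c.
Proof.
elim: c => //= x c [rs_c flat_c]; move: rs_c flat_c.
case: (runs c) => [|[|y r] rs] //=; first by move=> _ <-.
rewrite /is_run_seq /= => /andP[/andP[sr all_r] srs] <-.
case: leqP => [le_xy | lt_yx] /=; rewrite ?le_xy ?sr ?all_r //=.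
  by split=> //; case: rs srs {all_r}.
by rewrite {1}/descent_between /= lt_yx.
Qed.

(** Uniqueness of the factorization. It identifies the runs of a code obtained by altering the runs
    one by one. *)
Lemma runs_flatten rs : is_run_seq rs -> runs (flatten rs) = rs.
Proof.
elim: rs => // r rs IH /andP[/= /andP[/andP[r_gt0 sorted_r] all_rs] path_rs].
have {}IH : runs (flatten rs) = rs.
  by apply: IH; rewrite /is_run_seq all_rs (path_sorted path_rs).
elim: r r_gt0 sorted_r path_rs => // x [|y r] IHr _ /=.
  move=> _; rewrite IH {IH IHr}; case: rs all_rs => [|[|y r] rs] //= _.
  by rewrite {1}/descent_between /= ltnNge => /andP[/negPf->].
move=> /andP[le_xy p_yr] path_rs.
have /= -> := IHr isT p_yr; first by rewrite le_xy.
by move: path_rs; clear; case: rs.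
Qed.

(** A weakly increasing window cannot straddle the descent, so it lies inside [r] or inside [s]. *)
Lemma code_avoids_cat k i r s : 1 <= i <= k - 1 -> 0 < size r -> 0 < size s ->
  descent_between r s ->
  code_avoids k i (r ++ s) <-> code_avoids k i r /\ code_avoids k i s.
Proof.
move=> i_k r_gt0 s_gt0 desc; split=> [av | [av_r av_s] p].
  split=> p le_p incr.
    have := av p; rewrite size_cat !nth_cat; rewrite !ifT; try lia.
    apply; first lia.
    by move=> t lt_t; rewrite !nth_cat !ifT; [apply: incr | lia..].
  have := av (size r + p); rewrite size_cat !nth_cat !ifF; try lia.
  have -> : (size r + p + i).-1 - size r = (p + i).-1 by lia.
  have -> : size r + p + i - size r = p + i by lia.
  apply; first lia.
  move=> t lt_t; rewrite !nth_cat !ifF; try lia.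
  have -> : (size r + p + t).+1 - size r = (p + t).+1 by lia.
  have -> : size r + p + t - size r = p + t by lia.
  exact: incr.
rewrite size_cat => le_p incr.
case: (leqP (p + k) (size r)) => [le_pr | lt_rp].
  rewrite !nth_cat !ifT; try lia.
  apply: av_r => // t lt_t; have := incr t lt_t.
  by rewrite !nth_cat !ifT; try lia.
case: (ltnP p (size r)) => [lt_pr | le_rp].
  (* At this offset the window passes from the last entry of [r] to the head of [s]. *)
  have := incr ((size r).-1 - p); rewrite !nth_cat.
  have -> : p + ((size r).-1 - p) = (size r).-1 by lia.
  rewrite prednK // leqnn ltnn subnn nth_last nth0.
  by move: desc; rewrite /descent_between; lia.
rewrite !nth_cat !ifF; try lia.
have := av_s (p - size r).
have -> : (p - size r + i) = p + i - size r by lia.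
have -> : (p + i - size r).-1 = (p + i).-1 - size r by lia.
apply; first lia.
move=> t lt_t; have := incr t lt_t; rewrite !nth_cat !ifF; try lia.
have -> : (p - size r + t) = p + t - size r by lia.
by have -> : (p + t).+1 - size r = (p + t - size r).+1 by lia.
Qed.

Lemma code_avoids_flatten k i rs : 1 <= i <= k - 1 -> is_run_seq rs ->
  code_avoids k i (flatten rs) <-> (forall r, r \in rs -> code_avoids k i r).
Proof.
move=> i_k; elim: rs => [|r rs IH] /=.
  by move=> _; split=> // _ p /=; lia.
move=> /andP[/= /andP[/andP[r_gt0 sorted_r] all_rs] path_rs].
have {}IH : code_avoids k i (flatten rs) <-> (forall r, r \in rs -> code_avoids k i r).
  by apply: IH; rewrite /is_run_seq all_rs (path_sorted path_rs).
have split_cat : code_avoids k i (r ++ flatten rs) <->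
    code_avoids k i r /\ code_avoids k i (flatten rs).
  case: rs all_rs path_rs {IH} => [|r' rs] /=.
    by rewrite cats0 => _ _; split=> [av|[]//]; split=> // p /=; lia.
  move=> /andP[/andP[r'_gt0 _] _] /andP[desc _]; apply: code_avoids_cat => //.
    by rewrite size_cat addn_gt0 r'_gt0.
  by move: desc r'_gt0; case: r'.
rewrite split_cat IH; split=> [[av_r av_rs] r'|av].
  by rewrite inE => /orP[/eqP-> //|]; apply: av_rs.
by split=> [|r' r'_rs]; apply: av; rewrite inE ?eqxx // r'_rs orbT.
Qed.

(** * Moving the extra copies within one run *)

(* A run of [l >= k] letters satisfying [code_avoids k i] amounts to a weakly
   increasing word of [k - 1] letters whose [i]-th letter is followed by
   [m = l + 1 - k] extra copies of itself. Position [t] of the word where the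
   copies follow the [j]-th letter instead holds the letter at position
   [move_copies i j m t] of the original run; [m = 0] in shorter runs. *)
Definition move_copies (i j m t : nat) : nat :=
  let u := if t < j then t else maxn j.-1 (t - m) in
  if u < i then u else u + m.

Definition move_run (k i j : nat) (r : seq nat) : seq nat :=
  mkseq (fun t => nth 0 r (move_copies i j ((size r).+1 - k) t)) (size r).

Lemma size_move_run k i j r : size (move_run k i j r) = size r.
Proof. exact: size_mkseq. Qed.

Lemma move_copies_ltn k i j l t : 1 <= i <= k - 1 -> 1 <= j <= k - 1 ->
  t < l -> move_copies i j (l.+1 - k) t < l.
Proof. by rewrite /move_copies; do 2![case: ifP]; lia. Qed.

Lemma move_copies_mono i j m : {homo move_copies i j m : t u / t <= u}.
Proof.
move=> t u le_tu; rewrite /move_copies.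
set a := (if t < j then _ else _); set b := (if u < j then _ else _).
have : a <= b by rewrite /a /b; case: (ltnP t j); case: (ltnP u j); lia.
by case: (ltnP a i); case: (ltnP b i); lia.
Qed.

(** [move_copies] first collapses a position to its place [u] in the shortened word, then expands
    [u] again. Collapsing at [j] undoes expanding at [j]. *)
Lemma move_copies_trans i j h m t :
  move_copies i j m (move_copies j h m t) = move_copies i h m t.
Proof.
rewrite /move_copies.
set u := (if t < h then t else _).
suff -> : (if (if u < j then u else u + m) < j then if u < j then u else u + m
   else maxn j.-1 ((if u < j then u else u + m) - m)) = u by [].
by case: (ltnP u j) => [-> //|]; case: ltnP; lia.
Qed.

(** Every window of the run is increasing, so sliding the window from the start to the end chains
    the equalities of neighbours from position [i.-1] on. *)
Lemma sorted_code_nth k i r t : 1 <= i <= k - 1 -> sorted leq r ->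
  code_avoids k i r -> i.-1 <= t -> t < i + ((size r).+1 - k) ->
  k <= size r -> nth 0 r t = nth 0 r i.-1.
Proof.
move=> i_k sorted_r av le_it lt_t le_k.
have -> : t = i.-1 + (t - i.-1) by lia.
have : t - i.-1 <= (size r).+1 - k by lia.
elim: (t - _) => [|p IH] lt_p; first by rewrite addn0.
rewrite -IH; last lia.
have := av p; have -> : (p + i).-1 = i.-1 + p by lia.
have -> : p + i = i.-1 + p.+1 by lia.
move=> -> //; first lia.
by move=> u lt_u; apply: (sortedP 0 sorted_r); lia.
Qed.

(** With [i = j] only positions in the constant block are redirected, all of them to its first
    position [i.-1]. In runs shorter than [k] nothing moves. *)
Lemma move_run_id k i r : 1 <= i <= k - 1 -> sorted leq r ->
  code_avoids k i r -> move_run k i i r = r.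
Proof.
move=> i_k sorted_r av; rewrite /move_run -[RHS](mkseq_nth 0).
apply: (@eq_from_nth _ 0); rewrite !size_mkseq // => t lt_t.
rewrite !nth_mkseq //; case: (ltnP (size r) k) => [lt_rk | le_kr].
  by congr nth; rewrite /move_copies; do 2![case: ifP]; lia.
case: (ltnP t i) => [lt_ti|le_it]; first by rewrite /move_copies !lt_ti.
case: (leqP (i + ((size r).+1 - k)) t) => [le_t|lt_tm].
  by congr nth; rewrite /move_copies; do 2![case: ifP]; lia.
rewrite [RHS](sorted_code_nth i_k) //; last lia.
by congr nth; rewrite /move_copies; do 2![case: ifP]; lia.
Qed.

Lemma move_run_trans k i j h r : 1 <= j <= k - 1 -> 1 <= h <= k - 1 ->
  move_run k j h (move_run k i j r) = move_run k i h r.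
Proof.
move=> j_k h_k; apply: (@eq_from_nth _ 0); rewrite ?size_mkseq // => t lt_t.
rewrite {1}/move_run size_move_run nth_mkseq // nth_mkseq.
  by rewrite move_copies_trans nth_mkseq.
exact: move_copies_ltn.
Qed.

Lemma sorted_move_run k i j r : 1 <= i <= k - 1 -> 1 <= j <= k - 1 ->
  sorted leq r -> sorted leq (move_run k i j r).
Proof.
move=> i_k j_k sorted_r; apply/(sortedP 0) => t; rewrite size_move_run => lt_t.
rewrite !nth_mkseq //; last exact: ltnW.
apply: (sorted_leq_nth leq_trans leqnn 0 sorted_r).
- by rewrite inE move_copies_ltn // ltnW.
- by rewrite inE move_copies_ltn.
exact: move_copies_mono.
Qed.

Lemma head_move_run k i j r : 1 <= i <= k - 1 -> 1 <= j <= k - 1 ->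
  head 0 (move_run k i j r) = head 0 r.
Proof.
move=> i_k j_k; case: r => // x r; rewrite -!nth0 nth_mkseq //.
by congr nth; rewrite /move_copies; do 2![case: ifP]; lia.
Qed.

Lemma last_move_run k i j r : 1 <= i <= k - 1 -> 1 <= j <= k - 1 ->
  sorted leq r -> code_avoids k i r -> last 0 (move_run k i j r) = last 0 r.
Proof.
(* If [i = k - 1] and the run is long, the new last entry is read at position [k - 2], not at the
   end. Writing [r] as [move_run k i i r] makes both sides read the same position. *)
move=> i_k j_k sorted_r av; rewrite -[in RHS](move_run_id i_k sorted_r av).
case: (posnP (size r)) => [/size0nil-> //|r_gt0].
rewrite -!nth_last !size_move_run !nth_mkseq; try lia.
by congr nth; rewrite /move_copies; do 4![case: ifP]; lia.
Qed.

(** For each window start [p], positions [(p + j).-1] and [p + j] both collapse to [j.-1], hence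
    read the same entry of [r]. *)
Lemma code_avoids_move_run k i j r : 1 <= i <= k - 1 -> 1 <= j <= k - 1 ->
  code_avoids k j (move_run k i j r).
Proof.
move=> i_k j_k p; rewrite size_move_run => le_p _.
rewrite !nth_mkseq; try lia.
by congr nth; rewrite /move_copies; do 4![case: ifP]; lia.
Qed.

(** * Moving the copies in all runs of a code *)

Definition move_code (k i j : nat) (c : seq nat) : seq nat :=
  flatten (map (move_run k i j) (runs c)).

(** Heads and last entries of runs are kept, so the descents between consecutive runs survive and
    [runs_flatten] applies. *)
Lemma runs_move_code k i j c : 1 <= i <= k - 1 -> 1 <= j <= k - 1 ->
  code_avoids k i c -> runs (move_code k i j c) = map (move_run k i j) (runs c).
Proof.
move=> i_k j_k; have [rs_c {1}<-] := runs_spec c.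
move/(code_avoids_flatten i_k rs_c) => av; apply: runs_flatten.
case/andP: rs_c => all_rs desc_rs; apply/andP; split.
  rewrite all_map; apply/allP => r r_c /=.
  have /andP[r_gt0 sorted_r] := allP all_rs _ r_c.
  by rewrite size_move_run r_gt0 sorted_move_run.
rewrite sorted_map; move: desc_rs; apply: sub_in_sorted (allss _) => r s r_c s_c.
rewrite /relpre /= /descent_between head_move_run // last_move_run ?av //.
  by have /andP[] := allP all_rs _ r_c.
exact: av r_c.
Qed.

Lemma code_avoids_move_code k i j c : 1 <= i <= k - 1 -> 1 <= j <= k - 1 ->
  code_avoids k i c -> code_avoids k j (move_code k i j c).
Proof.
move=> i_k j_k av; have [rs_mc _] := runs_spec (move_code k i j c).
rewrite runs_move_code // in rs_mc.
apply/(code_avoids_flatten j_k rs_mc) => _ /mapP[r _ ->].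
exact: code_avoids_move_run.
Qed.

Lemma mem_runs k i c r : 1 <= i <= k - 1 -> code_avoids k i c -> r \in runs c ->
  [/\ 0 < size r, sorted leq r & code_avoids k i r].
Proof.
move=> i_k; have [rs_c {1}<-] := runs_spec c => /(code_avoids_flatten i_k rs_c) av r_c.
have /andP[r_gt0 sorted_r] := allP (andP rs_c).1 _ r_c.
by split=> //; apply: av.
Qed.

(** On each run the two moves compose to the move from [i] to [i], which fixes avoiding runs. *)
Lemma move_codeK k i j c : 1 <= i <= k - 1 -> 1 <= j <= k - 1 ->
  code_avoids k i c -> move_code k j i (move_code k i j c) = c.
Proof.
move=> i_k j_k av; rewrite {1}/move_code runs_move_code // -map_comp.
rewrite -[RHS](runs_spec c).2 -[in RHS](map_id (runs c)); congr flatten.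
apply/eq_in_map => r /(mem_runs i_k av)[_ sorted_r av_r] /=.
by rewrite move_run_trans // move_run_id.
Qed.

Lemma size_move_code k i j c : size (move_code k i j c) = size c.
Proof.
rewrite -[in RHS](runs_spec c).2 !size_flatten /shape -map_comp; congr sumn.
by apply: eq_map => r /=; rewrite size_move_run.
Qed.

Lemma head_move_code k i j c : 1 <= i <= k - 1 -> 1 <= j <= k - 1 ->
  head 0 (move_code k i j c) = head 0 c.
Proof.
move=> i_k j_k; rewrite /move_code -[in RHS](runs_spec c).2.
have [/andP[all_rs _] _] := runs_spec c.
case: (runs c) all_rs => //= r rs /andP[/andP[r_gt0 _] _].
have := head_move_run r i_k j_k; have := size_move_run k i j r.
by case: (move_run _ _ _ _) => [|? ?]; case: r r_gt0.
Qed.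

(** Along a run the entries grow while the bounds shrink, so the bound at the last entry implies the
    others. *)
Lemma subdiagonal_cat r s : 0 < size r -> sorted leq r ->
  subdiagonal (r ++ s) = (last 0 r <= size s) && subdiagonal s.
Proof.
elim: r => // x [//|y r] IH _ /andP[le_xy sorted_r].
have := IH isT sorted_r; rewrite [last 0 _]/= => <- /=.
case: leqP => //= lt_x; apply/esym/negP => /andP[le_y _].
by move: lt_x le_xy le_y; lia.
Qed.

Lemma subdiagonal_move_code k i j c : 1 <= i <= k - 1 -> 1 <= j <= k - 1 ->
  code_avoids k i c -> subdiagonal (move_code k i j c) = subdiagonal c.
Proof.
move=> i_k j_k av; rewrite -[in RHS](runs_spec c).2 /move_code.
(* The induction on the list of runs remembers only that each one occurs in [runs c], as [mem_runs]
   requires. *)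
have: {subset runs c <= runs c} by [].
elim: {1 3 4}(runs c) => //= r rs IH sub_rs.
have [|r_gt0 sorted_r av_r] := @mem_runs k i c r i_k av.
  by apply: sub_rs; rewrite mem_head.
have {}IH : subdiagonal (flatten (map (move_run k i j) rs)) = subdiagonal (flatten rs).
  by apply: IH => s s_rs; apply: sub_rs; rewrite inE s_rs orbT.
rewrite !subdiagonal_cat ?size_move_run ?sorted_move_run // last_move_run // IH.
congr ((_ <= _) && _); rewrite !size_flatten /shape -map_comp; congr sumn.
by apply: eq_map => s /=; rewrite size_move_run.
Qed.

(** * Ascents and equal neighbours in the Lehmer code *)

Lemma count_ltn_split x y s : x <= y -> count (fun z => z < y) s =
  count (fun z => z < x) s + count (fun z => x <= z < y) s.
Proof.
move=> le_xy; elim: s => //= z s ->.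
by case: (ltnP z x); case: (ltnP z y); rewrite /=; lia.
Qed.

(** The count at [t] also sees the letter at [t.+1]: at a descent this contributes the one unit that
    makes the inequality strict. *)
Lemma lehmer_ascent (s : seq nat) t : uniq s -> t.+1 < size s ->
  (nth 0 (lehmer s) t <= nth 0 (lehmer s) t.+1) = (nth 0 s t < nth 0 s t.+1).
Proof.
move=> uniq_s lt_t; rewrite !nth_lehmer ?(drop_nth 0 lt_t) //=; last exact: ltnW.
have neq : nth 0 s t != nth 0 s t.+1 by rewrite nth_uniq ?(ltnW lt_t) //; lia.
case: (ltngtP (nth 0 s t) (nth 0 s t.+1)) neq => // lt_xy _.
  by rewrite add0n count_ltn_mono // ltnW.
by apply/negbTE; rewrite -ltnNge add1n ltnS count_ltn_mono // ltnW.
Qed.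

(** At an ascent both counts range over the letters after [t.+1], and they differ by the number of
    those lying between the two letters. *)
Lemma lehmer_plateau (s : seq nat) t : uniq s -> t.+1 < size s ->
    nth 0 s t < nth 0 s t.+1 ->
  reflect (exists2 q, t.+1 < q < size s & nth 0 s t < nth 0 s q < nth 0 s t.+1)
    (nth 0 (lehmer s) t != nth 0 (lehmer s) t.+1).
Proof.
move=> uniq_s lt_t lt_xy; rewrite !nth_lehmer ?(drop_nth 0 lt_t) //=; last exact: ltnW.
rewrite [nth 0 s t.+1 < _]ltnNge (ltnW lt_xy) add0n (count_ltn_split _ (ltnW lt_xy)).
rewrite -[X in X == _]addn0 eqn_add2l eq_sym -lt0n -has_count.
apply: (iffP (has_nthP 0)) => [[q] | [q lt_q between]].
  rewrite size_drop nth_drop => lt_q /andP[le_x lt_y].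
  exists (t.+2 + q); first lia.
  rewrite lt_y andbT ltn_neqAle le_x andbT nth_uniq ?(ltnW lt_t) //; last by rewrite -ltn_subRL.
  by lia.
exists (q - t.+2); first by rewrite size_drop; lia.
by rewrite nth_drop subnKC //; lia.
Qed.

(** * One-line notation as a word on [iota 0 n] *)

Definition one_line (n : nat) (pi : 'S_n) : seq nat :=
  [seq val (pi q) | q <- enum 'I_n].

Lemma size_one_line n (pi : 'S_n) : size (one_line pi) = n.
Proof. by rewrite size_map size_enum_ord. Qed.

Lemma nth_one_line n (pi : 'S_n) (q : 'I_n) : nth 0 (one_line pi) q = pi q.
Proof. by rewrite (nth_map q) ?size_enum_ord // nth_ord_enum. Qed.

Lemma one_line_inj n : injective (@one_line n).
Proof.
move=> pi rho eq_l; apply/permP => q; apply: val_inj.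
by rewrite /= -!nth_one_line eq_l.
Qed.

Lemma perm_one_line n (pi : 'S_n) : perm_eq (one_line pi) (iota 0 n).
Proof.
rewrite /one_line -val_enum_ord map_comp perm_map //.
apply: uniq_perm => [||q]; [|exact: enum_uniq|].
  by rewrite map_inj_uniq ?enum_uniq //; apply: perm_inj.
rewrite mem_enum; apply/mapP.
by exists ((pi^-1)%g q); rewrite ?mem_enum ?permKV.
Qed.

Lemma uniq_one_line n (pi : 'S_n) : uniq (one_line pi).
Proof. by rewrite (perm_uniq (perm_one_line pi)) iota_uniq. Qed.

Lemma one_line_surj n (s : seq nat) : perm_eq s (iota 0 n) -> exists pi : 'S_n, one_line pi = s.
Proof.
move=> perm_s.
have size_s : size s = n by rewrite (perm_size perm_s) size_iota.
have uniq_s : uniq s by rewrite (perm_uniq perm_s) iota_uniq.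
pose f (q : 'I_n) := insubd q (nth 0 s q).
have val_f q : f q = nth 0 s q :> nat.
  rewrite val_insubd; have : nth 0 s q \in iota 0 n.
    by rewrite -(perm_mem perm_s) mem_nth ?size_s.
  by rewrite mem_iota /= => ->.
have inj_f : injective f.
  move=> p q /(congr1 val) /=; rewrite !val_f => /eqP.
  by rewrite nth_uniq ?size_s // => /eqP/val_inj.
exists (perm inj_f); apply: (@eq_from_nth _ 0) => [|q]; rewrite size_one_line ?size_s //.
by move=> lt_q; rewrite -[q]/(val (Ordinal lt_q)) nth_one_line permE val_f.
Qed.

(** * Occurrences of [sigma k i] and the code condition *)

Lemma val_sigma k i (p : 'I_k.+1) : i <= k ->
  vperm (sigma k i) p = (if p == k :> nat then i else bump i p) :> nat.
Proof.
move=> le_ik; rewrite /=; case: (unliftP ord_max p) => [p'|] ->.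
  rewrite lift_perm_lift perm1 lift_max /= inordK //.
  by rewrite ltn_eqF.
by rewrite lift_perm_id /= eqxx inordK.
Qed.

(** An occurrence is fixed by the start [p] of its consecutive block and the position [q] of its
    last letter; the order conditions reduce to neighbouring comparisons. *)
Lemma contains_sigmaP k i n (pi : 'S_n) (s := one_line pi) : 1 <= i <= k - 1 ->
  reflect (exists p q, [/\ p + k <= q, q < n,
      forall t, t.+1 < k -> nth 0 s (p + t) < nth 0 s (p + t).+1
    & nth 0 s (p + i).-1 < nth 0 s q < nth 0 s (p + i)])
  (contains (sigma k i) pi).
Proof.
move=> i_k; have le_ik : i <= k by lia.
apply: (iffP existsP) => [[f /and3P[/forallP incr /forallP iso /forallP adj]] | [p [q]]].
  pose F t : 'I_n := f (inord t : 'I_k.+1).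
  have F_incr t u : t < u <= k -> F t < F u.
    move=> lt_tu; have /forallP/(_ (inord u))/implyP := incr (inord t).
    by apply; rewrite !inordK //; lia.
  have F_iso t u : t <= k -> u <= k -> (nth 0 s (F t) < nth 0 s (F u)) =
      ((if t == k then i else bump i t) < (if u == k then i else bump i u)).
    move=> le_t le_u; have /forallP/(_ (inord u))/eqP := iso (inord t).
    by rewrite !nth_one_line => ->; rewrite !val_sigma // !inordK.
  have F_adj t : t.+1 < k -> F t.+1 = (F t).+1 :> nat.
    move=> lt_t; have lt_tk : t < k by lia.
    have /forallP/(_ (inord t))/forallP/(_ (inord t.+1))/implyP := adj (Ordinal lt_tk).
    move=> H; apply/eqP/H; rewrite inE /= !inordK ?eqxx ?andbT; lia.
  have FE t : t < k -> F t = F 0 + t :> nat.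
    elim: t => [|t IH] lt_t; first by rewrite addn0.
    by rewrite F_adj // IH ?addnS //; lia.
  exists (F 0), (F k); split=> //.
  - have := F_incr k.-1 k; rewrite FE; lia.
  - move=> t lt_t; rewrite -addnS -!FE; try lia.
    by rewrite F_iso; try lia; rewrite !ifF /bump; lia.
  have -> : (F 0 + i).-1 = F 0 + i.-1 by lia.
  rewrite -!FE; try lia.
  by rewrite !F_iso ?eqxx ?[i.-1 == k]ifF /bump; try lia; do 2![case: ifP]; lia.
move=> [le_pq lt_qn asc /andP[lt_q gt_q]].
have mono t u : t <= u -> u < k -> nth 0 s (p + t) <= nth 0 s (p + u).
  elim: u => [|u IH] le_tu lt_u; first by have -> : t = 0 by lia.
  case: (ltngtP t u.+1) le_tu => // [lt_tu|->] _ //.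
  by apply: leq_trans (IH _ _) _; rewrite ?addnS ?(ltnW (asc _ _)); lia.
have smono t u : t < u -> u < k -> nth 0 s (p + t) < nth 0 s (p + u).
  move=> lt_tu lt_u; apply: leq_trans (mono t.+1 u _ _) => //.
  by rewrite addnS asc //; lia.
pose g t := if t < k then p + t else q.
have g_incr t u : t < u < k.+1 -> g t < g u.
  by rewrite /g; case: (ltnP t k); case: (ltnP u k); lia.
pose f := [ffun t : 'I_k.+1 => insubd (Ordinal lt_qn) (g t)].
have fE (t : 'I_k.+1) : f t = g t :> nat.
  by rewrite ffunE val_insubd ifT // /g; case: (ltnP t k); lia.
have piE (t : 'I_k.+1) : pi (f t) = nth 0 s (g t) :> nat.
  by rewrite -fE nth_one_line.
(* This implication for all pairs suffices: exchanging [t] and [u] gives the converse, since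
   distinct positions carry distinct letters of the pattern. *)
have homo (t u : 'I_k.+1) : vperm (sigma k i) t < vperm (sigma k i) u ->
    pi (f t) < pi (f u).
  rewrite !val_sigma // !piE /g; have := ltn_ord t; have := ltn_ord u.
  rewrite !ltnS => le_u le_t.
  case: (ltngtP t k) le_t => // [lt_t|eq_t] _; case: (ltngtP u k) le_u => // [lt_u|eq_u] _.
  - move=> lt_b; apply: smono => //; move: lt_b; rewrite /bump; do 2![case: leqP]; lia.
  - move=> lt_b; apply: leq_ltn_trans lt_q.
    have -> : (p + i).-1 = p + i.-1 by lia.
    by apply: mono; move: lt_b; rewrite /bump; case: leqP; lia.
  - move=> lt_b; apply: leq_trans gt_q _.
    by apply: mono => //; move: lt_b; rewrite /bump; case: leqP; lia.
  by rewrite ltnn.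
exists f; apply/and3P; split.
- apply/forallP => t; apply/forallP => u; apply/implyP => lt_tu.
  by rewrite !fE g_incr // lt_tu ltn_ord.
- apply/forallP => t; apply/forallP => u; apply/eqP.
  apply/idP/idP; last exact: homo.
  apply: contraTT; rewrite -!leqNgt leq_eqVlt => /orP[/eqP/val_inj/perm_inj-> //|].
  by move/homo/ltnW.
apply/forallP => d; apply/forallP => t; apply/forallP => u.
apply/implyP => /and3P[]; rewrite inE => neq_d /eqP eq_t /eqP eq_u.
have lt_d : d.+1 < k by rewrite ltn_neqAle neq_d; apply: ltn_ord d.
by rewrite !fE /g eq_t eq_u lt_d (ltnW lt_d) addnS.
Qed.

Lemma avoiders_sigmaP k i n (pi : 'S_n) : 1 <= i <= k - 1 ->
  pi \in avoiders (sigma k i) n <-> code_avoids k i (lehmer (one_line pi)).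
Proof.
move=> i_k; rewrite inE; have uniq_s := uniq_one_line pi.
have size_s := size_one_line pi; split.
  move=> /(contains_sigmaP _ i_k) av p; rewrite size_lehmer size_s => le_p incr.
  have asc t : t.+1 < k -> nth 0 (one_line pi) (p + t) < nth 0 (one_line pi) (p + t).+1.
    by move=> lt_t; rewrite -lehmer_ascent ?incr // size_s; lia.
  have eq_pi : (p + i.-1).+1 = p + i by lia.
  have := @lehmer_plateau (one_line pi) (p + i.-1) uniq_s; rewrite eq_pi size_s.
  have := asc i.-1; rewrite eq_pi; have -> : p + i.-1 = (p + i).-1 by lia.
  move=> asc_i plateau; apply/eqP/negPn/negP => /plateau [||q lt_q btw].
  - lia.
  - by apply: asc_i; lia.
  apply: av; exists p, q; split=> //; last lia.
  (* [lehmer_plateau] only places [q] after [p + i]. Inside the window the later letters are at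
     least the one at [p + i], so [q] must lie beyond the window. *)
  rewrite leqNgt; apply/negP => lt_qp.
  have : forall u, i + u < k -> nth 0 (one_line pi) (p + i) <= nth 0 (one_line pi) (p + (i + u)).
    elim=> [|u IH] lt_u; first by rewrite addn0.
    rewrite addnS in lt_u *; apply: leq_trans (IH (ltnW lt_u)) _.
    by rewrite addnS ltnW // asc.
  move/(_ (q - (p + i))); have -> : p + (i + (q - (p + i))) = q by lia.
  by lia.
move=> av; apply/(contains_sigmaP _ i_k) => -[p [q [le_pq lt_q asc btw]]].
have eq_pi : (p + i).-1.+1 = p + i by lia.
have /eqP : nth 0 (lehmer (one_line pi)) (p + i).-1 = nth 0 (lehmer (one_line pi)) (p + i).
  apply: av => [|t lt_t]; first by rewrite size_lehmer size_s; lia.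
  by rewrite lehmer_ascent ?asc // size_s; lia.
apply/negP; rewrite -{2}eq_pi; apply/lehmer_plateau => //; rewrite ?eq_pi ?size_s; first lia.
  by case/andP: btw; apply: ltn_trans.
by exists q => //; lia.
Qed.

(** * Transport to permutations and counting *)

Lemma transport_avoiders k i j n : 1 <= i <= k - 1 -> 1 <= j <= k - 1 ->
  exists f : 'S_n -> 'S_n,
    [/\ {in avoiders (sigma k i) n &, injective f},
        {in avoiders (sigma k i) n, forall pi, f pi \in avoiders (sigma k j) n}
      & {in avoiders (sigma k i) n, forall pi,
          head 0 (lehmer (one_line (f pi))) = head 0 (lehmer (one_line pi))}].
Proof.
move=> i_k j_k.
pose c (pi : 'S_n) := lehmer (one_line pi).
pose f pi := odflt pi [pick rho | c rho == move_code k i j (c pi)].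
have fE : {in avoiders (sigma k i) n, forall pi, c (f pi) = move_code k i j (c pi)}.
  move=> pi /(avoiders_sigmaP _ i_k) av; rewrite /f; case: pickP => [rho /eqP//|].
  have [||s perm_s eq_s] := @lehmer_surj (move_code k i j (c pi)) _ (iota_uniq 0 n).
  - by rewrite size_iota size_move_code size_lehmer size_one_line.
  - by rewrite subdiagonal_move_code // subdiagonal_lehmer.
  have [rho eq_rho] := one_line_surj perm_s.
  by move/(_ rho); rewrite {1}/c eq_rho eq_s eqxx.
exists f; split=> [pi rho pi_av rho_av eq_f | pi pi_av | pi pi_av].
- apply: one_line_inj; apply: lehmer_inj.
    by rewrite (permPl (perm_one_line pi)) perm_sym perm_one_line.
  have := congr1 (fun x => move_code k j i (c x)) eq_f; rewrite /= !fE //.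
  by rewrite !move_codeK //; apply/avoiders_sigmaP.
- apply/(avoiders_sigmaP _ j_k); rewrite -[lehmer _]/(c _) fE //.
  by apply: code_avoids_move_code => //; apply/avoiders_sigmaP.
by rewrite -[lehmer _]/(c _) fE // head_move_code.
Qed.

(** All letters smaller than the first one come later, and with letters counted from 0 their number
    is the first letter itself. Keeping the head of the code thus keeps the first letter. *)
Lemma head_lehmer_one_line n (pi : 'S_n.+1) :
  head 0 (lehmer (one_line pi)) = pi ord0.
Proof.
rewrite -nth0 nth_lehmer ?size_one_line // -[X in nth 0 _ X]/(val (@ord0 n)).
rewrite nth_one_line drop1.
have := perm_one_line pi; have := nth_one_line pi ord0.
case: (one_line pi) => [_ /perm_size //|x s] /= -> /seq.permP cnt.
have := cnt (fun z => z < pi ord0); rewrite /= ltnn add0n => ->.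
have := @Order.POrderTheory.count_lt_nth _ nat 0 (iota 0 n.+1) (pi ord0).
by rewrite size_iota nth_iota // add0n; apply=> //; apply: iota_ltn_sorted.
Qed.

Lemma leq_card_avoiders_head k i j n (a : 'I_n.+1) :
  1 <= i <= k - 1 -> 1 <= j <= k - 1 ->
  #|[set pi in avoiders (sigma k i) n.+1 | pi ord0 == a]|
  <= #|[set pi in avoiders (sigma k j) n.+1 | pi ord0 == a]|.
Proof.
move=> i_k j_k; have [f [inj_f f_av f_head]] := transport_avoiders n.+1 i_k j_k.
rewrite -(@card_in_imset _ _ f) => [|pi rho]; last first.
  by rewrite !inE => /andP[pi_av _] /andP[rho_av _]; apply: inj_f; rewrite inE.
apply: subset_leq_card; apply/subsetP => _ /imsetP[pi pi_a ->].
move: pi_a; rewrite inE => /andP[pi_av /eqP <-].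
rewrite inE f_av //=; apply/eqP/val_inj.
by rewrite /= -!head_lehmer_one_line f_head.
Qed.

Lemma leq_card_sigma_avoiders k i j n : 1 <= i <= k - 1 -> 1 <= j <= k - 1 ->
  #|avoiders (sigma k i) n| <= #|avoiders (sigma k j) n|.
Proof.
move=> i_k j_k; have [f [inj_f f_av _]] := transport_avoiders n i_k j_k.
rewrite -(card_in_imset inj_f); apply: subset_leq_card.
by apply/subsetP => _ /imsetP[pi pi_av ->]; apply: f_av.
Qed.

Theorem theorem3p4 (k : nat) (hk : 3 <= k) :
  (forall i j : nat, 1 <= i <= k - 1 -> 1 <= j <= k - 1 ->
     wilf_equivalent (sigma k i) (sigma k j))
  /\
  (forall (n : nat) (a : 'I_n.+1) (i j : nat),
     1 <= i <= k - 1 -> 1 <= j <= k - 1 ->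
     #|[set pi in avoiders (sigma k i) n.+1 | pi ord0 == a]|
     = #|[set pi in avoiders (sigma k j) n.+1 | pi ord0 == a]|).
Proof.
(* The roles of [i] and [j] are interchangeable, so the injections in both directions give
   equality. *)
split=> [i j i_k j_k n | n a i j i_k j_k]; apply/eqP; rewrite eqn_leq.
  by rewrite !leq_card_sigma_avoiders.
by rewrite !leq_card_avoiders_head.
Qed.
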